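(* Consider the decentralized control problem with mean-field sharing described in the context. Define $V_{T+1}(z):=0$ for all $z\in\mathcal M_n$ and, recursively for $t=T,\dots,1$ and $z_t\in\mathcal M_n$, $$V_t(z_t):=\min_{\gamma_t}\Big(\hat\ell_t(z_t,\gamma_t)+\mathbb E[V_{t+1}(Z_{t+1})\mid Z_t=z_t,\Gamma_t=\gamma_t]\Big),$$ where the minimum is over all functions $\gamma_t:\mathcal X\to\mathcal U$. Let $\psi^*_t(z)$ be a minimizer of the right-hand side at time $t$ and $z_t=z$, and define $g^*_t(z,x):=\psi^*_t(z)(x)$ for $z\in\mathcal M_n$, $x\in\mathcal X$. Then $\mathbf g^*=(g_1^*,\dots,g_T^* )$, used as $U^i_t=g^*_t(Z_t,X^i_t)$ for all $i$ and $t$, is an optimal strategy: $J(\mathbf g^* )\le J(\mathbf g)$ for every control strategy $\mathbf g=(g_1,\dots,g_T)$ of the form $U^i_t=g_t(Z_{1:t},X^i_t)$, $i=1,\dots,n$ (identical control laws at all controllers).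
   Context: Model. $n,T\in\mathbb N$; $\mathcal X$ (states) and $\mathcal U$ (actions) are finite sets. Subsystem $i\in\{1,\dots,n\}$ has state $X^i_t\in\mathcal X$ and action $U^i_t\in\mathcal U$ at time $t$; $\mathbf X_t=(X^1_t,\dots,X^n_t)$, $\mathbf U_t=(U^1_t,\dots,U^n_t)$. The mean-field is $Z_t=\frac1n\sum_{i=1}^n\delta_{X^i_t}$, i.e. $Z_t(x)=\frac1n\sum_{i}\mathbb 1(X^i_t=x)$, taking values in the set $\mathcal M_n$ of probability distributions on $\mathcal X$ whose values all lie in $\{0,\frac1n,\dots,\frac nn\}$. Dynamics: $X^i_{t+1}=f_t(X^i_t,U^i_t,W^i_t,Z_t)$ for $t=1,\dots,T$, with given functions $f_t$ not depending on $i$. The initial states $X^i_1$ have common PMF $P_X$, the noises $W^i_t$ are discrete with PMF $P_{W_t}$ (not depending on $i$), and all of $X^1_1,\dots,X^n_1$, $W^i_t$ ($1\le i\le n$, $1\le t\le T$) are mutually independent. Costs: arbitrary functions $\ell_t:\mathcal X^n\times\mathcal U^n\to\mathbb R$. Decentralized problem (mean-field sharing). Controller $i$ observes $Z_{1:t}=(Z_1,\dots,Z_t)$ and $X^i_t$. Control laws are pure (deterministic) and identical at all controllers: $U^i_t=g_t(Z_{1:t},X^i_t)$ with $g_t:\mathcal M_n^t\times\mathcal X\to\mathcal U$; $\mathbf g=(g_1,\dots,g_T)$ is the control strategy. Its cost is $J(\mathbf g)=\mathbb E^{\mathbf g}[\sum_{t=1}^T\ell_t(\mathbf X_t,\mathbf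 U_t)]$, the expectation being under the law induced by $\mathbf g$. Optimal means minimizing $J$ over all such $\mathbf g$. Notation in the dynamic program. For $\gamma:\mathcal X\to\mathcal U$ write $\ell_t(\mathbf x,\gamma):=\ell_t(\mathbf x,(\gamma(x^1),\dots,\gamma(x^n)))$. For $z\in\mathcal M_n$ let $H(z)=\{\mathbf x\in\mathcal X^n:\frac1n\sum_i\delta_{x^i}=z\}$ and $\hat\ell_t(z,\gamma):=\frac1{|H(z)|}\sum_{\mathbf x\in H(z)}\ell_t(\mathbf x,\gamma)$. Here $\Gamma_t:\mathcal X\to\mathcal U$ denotes the map applied by all controllers at time $t$ ($U^i_t=\Gamma_t(X^i_t)$, $\Gamma_t=g_t(Z_{1:t},\cdot)$). The conditional law of $Z_{t+1}$ given $Z_t=z,\Gamma_t=\gamma$ is the law of $\frac1n\sum_i\delta_{f_t(x^i,\gamma(x^i),W^i_t,z)}$ with $\mathbf x$ uniform on $H(z)$ and independent of $(W^1_t,\dots,W^n_t)$; this defines the conditional expectation for all $(z,\gamma)$, including pairs of probability zero. *)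

(* Defs.v *)
From HB Require Import structures.
From mathcomp Require Import all_boot all_order all_algebra.
From mathcomp Require Import all_classical all_reals all_analysis.

Set Implicit Arguments.
Unset Strict Implicit.
Unset Printing Implicit Defensive.

Import Order.TTheory GRing.Theory Num.Theory.
Local Open Scope classical_set_scope.
Local Open Scope ring_scope.

(* Times are 0-based: [t : nat] stands for time t+1, so the horizon is
   t = 0, ..., T-1 and the terminal time T+1 is [T]. *)

Section DiscreteRandomVariables.
Context {d : measure_display} {Omega : measurableType d} {R : realType}.
Variable P : probability Omega R.

(* [Y] is a discrete random variable with probability mass function [p];
   nonnegativity and total mass 1 of [p] follow from those of [P]. *)
Definition has_pmf (E : countType) (Y : Omega -> E) (p : E -> R) : Prop :=
  forall y, measurable (Y @^-1` [set y]) /\ P (Y @^-1` [set y]) = (p y)%:E.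

(* The events of the form {Y in B}. *)
Definition events_of (E : Type) (Y : Omega -> E) : set (set Omega) :=
  [set Y @^-1` B | B in [set: set E]].

Definition mutually_independent (I : finType) (F : I -> set (set Omega)) : Prop :=
  forall (J : {set I}) (A : I -> set Omega),
    (forall i, i \in J -> F i (A i)) ->
    P (\bigcap_(i in [set j | j \in J]) A i) = (\prod_(i in J) P (A i))%E.

End DiscreteRandomVariables.

Section MeanField.
Variables (R : realType) (X : finType) (n : nat).

Definition is_mean_field (z : {ffun X -> R}) : bool :=
  [forall x, [exists k : 'I_n.+1, z x == k%:R / n%:R]] && (\sum_x z x == 1).

Definition Mn : Type := {z : {ffun X -> R} | is_mean_field z}.

Definition empirical (x : {ffun 'I_n -> X}) : {ffun X -> R} :=
  [ffun a => n%:R^-1 * \sum_(i < n) (x i == a)%:R].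

Lemma empirical_mean_field (x : {ffun 'I_n -> X}) :
  (0 < n)%N -> is_mean_field (empirical x).
Proof.
move=> n_gt0; have n0 : n%:R != 0 :> R by rewrite pnatr_eq0 -lt0n.
apply/andP; split.
  apply/forallP => a; apply/existsP.
  have lt_n : (\sum_(i < n) (x i == a) < n.+1)%N.
    rewrite ltnS -[leqRHS]card_ord -sum1_card.
    by apply: leq_sum => i _; case: (x i == a).
  by exists (Ordinal lt_n); rewrite ffunE /= natr_sum mulrC.
apply/eqP; under eq_bigr do rewrite ffunE.
rewrite -mulr_sumr exchange_big /=.
under eq_bigr => i _.
  rewrite (bigD1 (x i)) //= eqxx big1 ?addr0; last first.
    by move=> a; rewrite eq_sym => /negbTE ->.
  over.
by rewrite sumr_const card_ord mulVf.
Qed.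

Definition mean_field (n_gt0 : (0 < n)%N) (x : {ffun 'I_n -> X}) : Mn :=
  exist is_mean_field (empirical x) (empirical_mean_field x n_gt0).

Definition H (n_gt0 : (0 < n)%N) (z : Mn) : {set {ffun 'I_n -> X}} :=
  [set x | mean_field n_gt0 x == z]%SET.

End MeanField.

Section ControlProblem.
Context {d : measure_display} {Omega : measurableType d} {R : realType}.
Variables (P : probability Omega R) (X U : finType) (calW : nat -> countType).
Variables (n T : nat) (n_gt0 : (0 < n)%N).
Variable f : forall t, X -> U -> calW t -> Mn R X n -> X.
Variable ell : nat -> {ffun 'I_n -> X} -> {ffun 'I_n -> U} -> R.
Variables (X1 : 'I_n -> Omega -> X) (W : forall t, 'I_n -> Omega -> calW t).

Definition primitive_events (k : 'I_n + 'I_T * 'I_n) : set (set Omega) :=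
  match k with
  | inl i => events_of (X1 i)
  | inr (t, i) => events_of (@W t i)
  end.

(* The history Z_{1:t} at the time coded by [t] has length [t.+1]. *)
Definition strategy : Type := forall t, t.+1.-tuple (Mn R X n) -> X -> U.

(* Global state together with the history of mean-fields up to and including
   the current one. *)
Fixpoint trajectory (g : strategy) (omega : Omega) (t : nat) :
    {ffun 'I_n -> X} * t.+1.-tuple (Mn R X n) :=
  match t with
  | 0 => let x := [ffun i => X1 i omega] in (x, [tuple mean_field R n_gt0 x])
  | s.+1 =>
      let: (x, h) := trajectory g omega s in
      let x' := [ffun i => f (x i) (g s h (x i)) (W s i omega)
                             (mean_field R n_gt0 x)] in
      (x', [tuple of rcons h (mean_field R n_gt0 x')])
  end.

Definition state (g : strategy) (omega : Omega) (t : nat) : {ffun 'I_n -> X} :=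
  (trajectory g omega t).1.

Definition action (g : strategy) (omega : Omega) (t : nat) : {ffun 'I_n -> U} :=
  [ffun i => g t (trajectory g omega t).2 (state g omega t i)].

Definition J (g : strategy) : \bar R :=
  ('E_P[fun omega =>
      (\sum_(t < T) ell t (state g omega t) (action g omega t))%R])%E.

Definition ell_hat (t : nat) (z : Mn R X n) (gamma : X -> U) : R :=
  #|H n_gt0 z|%:R^-1 *
    \sum_(x in H n_gt0 z) ell t x [ffun i => gamma (x i)].

(* E[v(Z_{t+1}) | Z_t = z, Gamma_t = gamma]: the state is averaged uniformly
   over H(z), independently of the noise at time t.  The inner expectation is
   that of a function with finitely many values, so [fine] loses nothing. *)
Definition cond_expectation (t : nat) (v : Mn R X n -> R) (z : Mn R X n)
    (gamma : X -> U) : R :=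
  #|H n_gt0 z|%:R^-1 *
    \sum_(x in H n_gt0 z)
      fine ('E_P[fun omega => v (mean_field R n_gt0
              [ffun i => f (x i) (gamma (x i)) (W t i omega) z])])%E.

Definition dp_rhs (t : nat) (v : Mn R X n -> R) (z : Mn R X n)
    (gamma : X -> U) : R :=
  ell_hat t z gamma + cond_expectation t v z gamma.

Definition is_minimum (A : set R) (m : R) : Prop := A m /\ lbound A m.

Definition dp_value (V : nat -> Mn R X n -> R) : Prop :=
  (forall z, V T z = 0) /\
  forall t z, (t < T)%N -> is_minimum (range (dp_rhs t (V t.+1) z)) (V t z).

Definition dp_minimizer (V : nat -> Mn R X n -> R)
    (psi : nat -> Mn R X n -> X -> U) : Prop :=
  forall t z gamma, (t < T)%N ->
    dp_rhs t (V t.+1) z (psi t z) <= dp_rhs t (V t.+1) z gamma.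

(* A sequence of maps g_t(z, x) used through the current mean-field only. *)
Definition markov_strategy (g : nat -> Mn R X n -> X -> U) : strategy :=
  fun t h x => g t (tnth h ord_max) x.

End ControlProblem.

Arguments strategy R X U n : clear implicits.
Arguments primitive_events {d Omega X calW n} T X1 W k _.

(* Main.v *)
Require Import Defs.
From mathcomp Require Import all_boot all_order all_algebra perm.
From mathcomp Require Import all_classical all_reals all_analysis.
Import Order.TTheory GRing.Theory Num.Theory.
Local Open Scope ring_scope.

(** Only exchangeability of the population is at work.  The law of the initial
    state is invariant under relabelling the subsystems, and so is the transition
    law, because all subsystems have the same dynamics, noise law and control
    law.  Two states have the same mean-field exactly when one is a relabelling
    of the other ([eq_mean_field_relabel]); hence a relabelling-invariant weight
    is constant on every class [H z], and in a weighted sum any function of the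
    state may be replaced by its average over the class ([exchangeable_sum]).
    This is the statement that, given the history of the mean-fields, the state
    is uniform on the class of the current mean-field, whatever the strategy.
    The pair (history, prescription) therefore sees costs and transitions only
    through [ell_hat] and [cond_expectation], and the mean-field behaves as the
    state of a fully observed Markov decision process.

    Expectations reduce to finite sums.  [cost_to_go g k x h] is the cost of [k] stages
    when the strategy [g] is started from a deterministic state [x] and a
    deterministic history [h]; it depends only on the noise that is still to
    come, so by independence its mean given an event of the past obeys a finite recursion
    [mean_cost_to_go] ([has_mean_cost_to_go]).  Starting from deterministic data
    keeps all sums finite: a strategy takes arbitrary histories as arguments,
    but no law on histories ever appears.

    The class average of [mean_cost_to_go] satisfies a one-step recursion whose
    right-hand side is that of the dynamic program at the prescription chosen by
    [g] ([class_mean_cost_to_goS]).  Backward induction gives that this average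
    is at least the value function for every [g] ([dp_value_le_cost]), and is
    equal to it for the strategy of minimizers ([dp_value_eq_cost]).  Both costs
    are the averages of these quantities under the same law of the initial
    mean-field ([cost_mean_class]), which proves optimality. *)

Set Implicit Arguments.
Unset Strict Implicit.
Unset Printing Implicit Defensive.

(** * Relabelling the subsystems and averaging over mean-field classes *)

Section Exchangeability.
Context {R : realType} {X : finType} {n : nat} (n_gt0 : (0 < n)%N).
Local Notation S := {ffun 'I_n -> X}.
Local Notation mf := (mean_field R n_gt0).

Definition relabel (s : 'S_n) (x : S) : S := [ffun i => x (s i)].

Lemma relabelK (s : 'S_n) : cancel (relabel s) (relabel s^-1%g).
Proof. by move=> x; apply/ffunP => i; rewrite !ffunE permKV. Qed.

Lemma mean_field_relabel s (x : S) : mf (relabel s x) = mf x.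
Proof.
apply/val_inj/ffunP => a /=; rewrite !ffunE; congr (_ * _).
rewrite [RHS](reindex_inj (@perm_inj _ s)) /=.
by apply: eq_bigr => i _; rewrite ffunE.
Qed.

Lemma mean_field_count (x : S) (a : X) :
  val (mf x) a = n%:R^-1 * (count_mem a [tuple x i | i < n])%:R.
Proof.
rewrite /= ffunE; congr (_ * _).
rewrite -natr_sum; congr (_%:R).
rewrite count_map -sum1_count [RHS]big_mkcond /= big_enum /=.
by apply: eq_bigr => i _; case: eqP.
Qed.

(** The mean-field lists the multiplicities of the local states, so two states
    with the same mean-field are permutations of one another. *)
Lemma eq_mean_field_relabel (x y : S) :
  mf x = mf y -> exists s, x = relabel s y.
Proof.
move=> eq_mf.
have n_neq0 : (n%:R^-1 : R) != 0 by rewrite invr_eq0 pnatr_eq0 -lt0n.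
have /tuple_permP[s eq_s] : perm_eq [tuple x i | i < n] [tuple y i | i < n].
  apply/allP => a _ /=; apply/eqP.
  have := congr1 (fun z : Mn R X n => val z a) eq_mf.
  by rewrite !mean_field_count => /(mulfI n_neq0)/eqP; rewrite eqr_nat => /eqP.
exists s; apply/ffunP => i; rewrite ffunE.
have /val_inj eq_t := eq_s.
by have := congr1 (fun t => tnth t i) eq_t; rewrite !tnth_mktuple.
Qed.

Definition exchangeable (m : S -> R) : Prop :=
  forall s x, m (relabel s x) = m x.

Definition class_mean (z : Mn R X n) (phi : S -> R) : R :=
  #|H n_gt0 z|%:R^-1 * \sum_(x in H n_gt0 z) phi x.

Lemma mem_H (x : S) (z : Mn R X n) : (x \in H n_gt0 z) = (mf x == z).
Proof. by rewrite inE. Qed.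

Lemma card_H_neq0 (x : S) : #|H n_gt0 (mf x)|%:R != 0 :> R.
Proof.
by rewrite pnatr_eq0 cards_eq0; apply/set0Pn; exists x; rewrite mem_H.
Qed.

(** Both sides are the sum of [m x * phi x / #|H (mf x)|] over the pairs [(x, y)]
    in the same class: [m] has the same value at [x] and [y], so the roles of the
    two may be exchanged.  This replaces the assertion that the state is
    conditionally uniform given the mean-field. *)
Lemma exchangeable_sum (m phi : S -> R) : exchangeable m ->
  \sum_x m x * phi x = \sum_x m x * class_mean (mf x) phi.
Proof.
move=> mE.
have mH x y : mf x = mf y -> m x = m y.
  by case/eq_mean_field_relabel => s ->; exact: mE.
transitivity (\sum_x \sum_(y | mf y == mf x)
   #|H n_gt0 (mf x)|%:R^-1 * (m x * phi x)).
  apply: eq_bigr => x _; rewrite sumr_const -mulrnAl.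
  rewrite -[_ *+ _]mulr_natr (_ : #|_| = #|H n_gt0 (mf x)|); last first.
    by apply: eq_card => y; rewrite mem_H.
  by rewrite mulVf ?mul1r // card_H_neq0.
rewrite (exchange_big_dep xpredT) //=; apply: eq_bigr => y _.
rewrite /class_mean mulrCA !mulr_sumr; apply: eq_big => [x|x /eqP eq_yx].
  by rewrite mem_H eq_sym.
by rewrite eq_yx (mH _ _ eq_yx).
Qed.

Lemma class_meanD z (phi phi' : S -> R) :
  class_mean z (fun x => phi x + phi' x) = class_mean z phi + class_mean z phi'.
Proof. by rewrite /class_mean big_split mulrDr. Qed.

Lemma eq_class_mean z (phi phi' : S -> R) :
  (forall x, mf x = z -> phi x = phi' x) -> class_mean z phi = class_mean z phi'.
Proof.
move=> eq_phi; congr (_ * _); apply: eq_bigr => x; rewrite mem_H => /eqP.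
exact: eq_phi.
Qed.

Lemma class_mean_le z (phi phi' : S -> R) :
  (forall x, phi x <= phi' x) -> class_mean z phi <= class_mean z phi'.
Proof.
move=> le_phi; apply: ler_wpM2l; first by rewrite invr_ge0 ler0n.
exact: ler_sum.
Qed.

Lemma class_mean_relabel s z (phi : S -> R) :
  class_mean z (phi \o relabel s) = class_mean z phi.
Proof.
congr (_ * _); rewrite [RHS](reindex_inj (can_inj (relabelK s))) /=.
by apply: eq_bigl => x; rewrite !mem_H mean_field_relabel.
Qed.

End Exchangeability.

(** * Expectations of finite combinations of events *)

Section Expectation.
Context {d : measure_display} {Omega : measurableType d} {R : realType}.
Variable P : probability Omega R.
Local Open Scope classical_set_scope.

Definition pr (A : set Omega) : R := fine (P A).

Lemma prE A : measurable A -> P A = (pr A)%:E.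
Proof. by move=> mA; rewrite fineK ?fin_num_measure. Qed.

Let expectationE (F : Omega -> R) : 'E_P[F]%E = (\int[P]_w (F w)%:E)%E.
Proof. by rewrite expectation.unlock. Qed.

(** Integrability is carried along with the value because linearity of the
    integral needs it at each step. *)
Definition has_mean (F : Omega -> R) (m : R) : Prop :=
  P.-integrable setT (EFin \o F) /\ 'E_P[F]%E = m%:E.

Lemma has_mean_indic A : measurable A -> has_mean \1_A (pr A).
Proof.
move=> mA; split; first exact: integrable_indic.
by rewrite expectation_indic // prE.
Qed.

Lemma has_meanZ a F m : has_mean F m -> has_mean (fun w => a * F w) (a * m).
Proof.
move=> [iF EF]; split.
  by apply: eq_integrable (integrableZl measurableT a iF) => // w _.
rewrite expectationE; under eq_integral do rewrite EFinM.
by rewrite integralZl // -expectationE EF.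
Qed.

Lemma has_meanD F G a b :
  has_mean F a -> has_mean G b -> has_mean (F \+ G) (a + b).
Proof.
move=> [iF EF] [iG EG]; split.
  by apply: eq_integrable (integrableD measurableT iF iG) => // w _.
rewrite expectationE; under eq_integral do rewrite EFinD.
by rewrite integralD // -!expectationE EF EG.
Qed.

Lemma has_mean_sum (I : finType) (F : I -> Omega -> R) (m : I -> R) :
  (forall i, has_mean (F i) (m i)) ->
  has_mean (fun w => \sum_i F i w) (\sum_i m i).
Proof.
move=> meanF; split.
  apply: eq_integrable
    (integrable_sum measurableT _ (fun i _ => (meanF i).1)) => // w _.
  by rewrite /= sumEFin.
rewrite expectationE; under eq_integral do rewrite -sumEFin.
rewrite integral_sum // => [|i]; last exact: (meanF i).1.
rewrite -sumEFin; apply: eq_bigr => i _.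
by rewrite -(meanF i).2 expectationE.
Qed.

Lemma eq_has_mean F G a b : has_mean F a -> F =1 G -> a = b -> has_mean G b.
Proof. by move=> Fa /funext <- <-. Qed.

(** An event about a discrete variable is split into atoms indexed by the codes of
    its values, so that countable additivity applies to a sequence of sets. *)
Section PmfDetermines.
Context {E : countType} {p : E -> R}.

Let support (B : set E) : set nat :=
  [set k | if pickle_inv k is Some y then B y else False].
Let atom (Y : Omega -> E) (k : nat) : set Omega :=
  if pickle_inv k is Some y then Y @^-1` [set y] else set0.
Let mass (k : nat) : \bar R := if pickle_inv k is Some y then (p y)%:E else 0%E.

Let preimage_atoms (Y : Omega -> E) (B : set E) :
  Y @^-1` B = \bigcup_(k in support B) atom Y k.
Proof.
apply/seteqP; split=> w.
  move=> BYw; exists (pickle (Y w)); rewrite /support/= /atom /=.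
    by rewrite pickleK_inv.
  by rewrite pickleK_inv.
move=> [k]; rewrite /support /atom /=.
by case: pickle_inv => // y By /= ->.
Qed.

Variable Y : Omega -> E.
Hypothesis Yp : has_pmf P Y p.

Let measurable_atom k : measurable (atom Y k).
Proof. by rewrite /atom; case: pickle_inv => // y; case: (Yp y). Qed.

Lemma has_pmf_measurable (B : set E) : measurable (Y @^-1` B).
Proof. by rewrite preimage_atoms; apply: bigcup_measurable. Qed.

Lemma has_pmf_prob_series (B : set E) :
  P (Y @^-1` B) = (\sum_(0 <= k <oo | k \in support B) mass k)%E.
Proof.
rewrite preimage_atoms measure_bigcup //.
  apply: eq_eseriesr => k _; rewrite /atom /mass.
  by case: pickle_inv => [y|]; [case: (Yp y)|rewrite measure0].
move=> j k _ _ [w []]; rewrite /atom.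
have := pickle_invK j (T := E); have := pickle_invK k (T := E).
case: (pickle_inv k) (pickle_inv j) => [a|] [b|] //= ka jb wb wa.
by rewrite -jb -ka -wa -wb.
Qed.
End PmfDetermines.

Lemma has_pmf_eq_prob (E : countType) (p : E -> R) (Y Y' : Omega -> E) :
  has_pmf P Y p -> has_pmf P Y' p ->
  forall B, P (Y @^-1` B) = P (Y' @^-1` B).
Proof.
by move=> Yp Y'p B; rewrite (has_pmf_prob_series Yp) (has_pmf_prob_series Y'p).
Qed.

End Expectation.

(** * The controlled system *)

Section Control.
Context {R : realType} {d : measure_display} {Omega : measurableType d}.
Context {P : probability Omega R} {X U : finType} {calW : nat -> countType}.
Context {n T : nat} (n_gt0 : (0 < n)%N).
Variable f : forall t, X -> U -> calW t -> Mn R X n -> X.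
Variable ell : nat -> {ffun 'I_n -> X} -> {ffun 'I_n -> U} -> R.
Variables (X1 : 'I_n -> Omega -> X) (W : forall t, 'I_n -> Omega -> calW t).
Variables (PX : X -> R) (PW : forall t, calW t -> R).
Hypothesis X1_pmf : forall i, has_pmf P (X1 i) PX.
Hypothesis W_pmf : forall t i, (t < T)%N -> has_pmf P (W t i) (@PW t).
Hypothesis indep : mutually_independent P (primitive_events T X1 W).

Local Open Scope classical_set_scope.
Local Notation S := {ffun 'I_n -> X}.
Local Notation history t := (t.+1.-tuple (Mn R X n)).
Local Notation index := ('I_n + 'I_T * 'I_n)%type.
Local Notation mf := (mean_field R n_gt0).
Local Notation strategy := (strategy R X U n).

(** The noise values that send subsystem [i] to its component of [x']; a joint
    transition is thus an intersection of events, one per noise variable, which is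
    the form that independence requires. *)
Definition moves_to t (x : S) (gamma : X -> U) (x' : S) (i : 'I_n) :
    set (calW t) :=
  [set w | f (x i) (gamma (x i)) w (mf x) = x' i].

Arguments moves_to : clear implicits.

Definition transition_prob t (x : S) (gamma : X -> U) (x' : S) : R :=
  \prod_i pr P (W t i @^-1` moves_to t x gamma x' i).

(** Relabelling both states permutes the factors, and the noises of different
    subsystems have the same law. *)
Lemma transition_prob_relabel t x gamma x' s : (t < T)%N ->
  transition_prob t (relabel s x) gamma (relabel s x') =
  transition_prob t x gamma x'.
Proof.
move=> tT; rewrite /transition_prob [RHS](reindex_inj (@perm_inj _ s)) /=.
apply: eq_bigr => i _; rewrite /pr /moves_to mean_field_relabel !ffunE.
by rewrite (has_pmf_eq_prob (W_pmf i tT) (W_pmf (s i) tT)).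
Qed.

Definition next_state t (x : S) (gamma : X -> U) (w : Omega) : S :=
  [ffun i => f (x i) (gamma (x i)) (W t i w) (mf x)].

(** Recursion is on the number [k] of remaining stages, while the time [t] and the
    history go up.  State and history are arguments rather than functions of the
    outcome, so this reads the noise from time [t] on only. *)
Fixpoint cost_to_go (g : strategy) k t (x : S) (h : history t) w : R :=
  if k is k'.+1 then
    ell t x [ffun i => g t h (x i)] +
    let x' := next_state t x (g t h) w in
    cost_to_go g k' x' [tuple of rcons h (mf x')] w
  else 0.

Fixpoint mean_cost_to_go (g : strategy) k t (x : S) (h : history t) : R :=
  if k is k'.+1 then
    ell t x [ffun i => g t h (x i)] +
    \sum_x' transition_prob t x (g t h) x' *
      mean_cost_to_go g k' x' [tuple of rcons h (mf x')]
  else 0.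

(** The primitive variables that determine the state at time [t]: events of the
    past are intersections of primitive events over this index set. *)
Definition before t : {set index} :=
  [set k : index | if k is inr (s, _) then (s < t)%N else true]%SET.

Definition cylinder t (A : index -> set Omega) : set Omega :=
  \bigcap_(k in [set j | j \in before t]) A k.

Definition primitive (A : index -> set Omega) : Prop :=
  forall k, primitive_events T X1 W k (A k).

Lemma primitive_measurable A k : primitive A -> measurable (A k).
Proof.
move/(_ k); case: k => [i|[t i]] /= [B _ <-].
  exact: has_pmf_measurable (X1_pmf i) B.
exact: has_pmf_measurable (W_pmf i (ltn_ord t)) B.
Qed.

Lemma cylinder_measurable t A : primitive A -> measurable (cylinder t A).
Proof.
move=> pA; apply: fin_bigcap_measurable => [|k _].
  exact: finite_finset.
exact: primitive_measurable.
Qed.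

Lemma cylinder_prob t A : primitive A ->
  pr P (cylinder t A) = \prod_(k in before t) pr P (A k).
Proof.
move=> pA; rewrite /pr /cylinder indep; last by move=> k _; exact: pA.
rewrite (eq_bigr (fun k => (pr P (A k))%:E)); last first.
  by move=> k _; rewrite prE //; exact: primitive_measurable.
by rewrite prodEFin.
Qed.

(** Past events stay of the same form after a transition has been imposed at time
    [t]: its noise events are put into the family at the indices that separate
    [before t] from [before t.+1]. *)
Definition add_move (A : index -> set Omega) t x gamma x' (k : index) :
    set Omega :=
  match k with
  | inl _ => A k
  | inr (s, i) => if s == t :> nat
                  then W s i @^-1` moves_to s x gamma x' i else A k
  end.

Lemma add_move_primitive A t x gamma x' :
  primitive A -> primitive (add_move A t x gamma x').
Proof.
move=> pA [i|[s i]] /=; first exact: (pA (inl i)).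
by case: eqP => _; [exists (moves_to s x gamma x' i)|exact: (pA (inr (s, i)))].
Qed.

(** The indices of the transition lie outside [before t], so mutual independence
    splits off their product, which is the transition probability. *)
Lemma add_move_prob A t x gamma x' : primitive A -> (t < T)%N ->
  pr P (cylinder t.+1 (add_move A t x gamma x')) =
  pr P (cylinder t A) * transition_prob t x gamma x'.
Proof.
move=> pA tT; rewrite !cylinder_prob //; last exact: add_move_primitive.
have -> : before t.+1 =
    (before t :|: [set inr (Ordinal tT, i) | i : 'I_n])%SET.
  apply/setP => -[i|[s i]]; rewrite !inE //= ltnS leq_eqVlt orbC.
  congr (_ || _); apply/eqP/imsetP => [st|[j _ [-> _]] //].
  by exists i => //; congr (inr (_, _)); apply: val_inj.
rewrite (eq_bigl _ _ (fun k => finset.in_setU k _ _)) bigU /=; last first.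
  rewrite disjoint_sym disjoint_subset.
  apply/fintype.subsetP => k /imsetP[i _ ->].
  by rewrite !inE /= ltnn.
rewrite big_imset /= => [|i j _ _ [] //]; congr (_ * _).
  apply: eq_bigr => -[i|[s i]] //=; rewrite inE => /ltn_eqF -> //.
by apply: eq_bigr => i _; rewrite eqxx.
Qed.

Lemma indic_add_move A t x gamma x' w : (t < T)%N ->
  \1_(cylinder t.+1 (add_move A t x gamma x')) w =
  \1_(cylinder t A) w * (next_state t x gamma w == x')%:R :> R.
Proof.
move=> tT; rewrite !indicE -natrM mulnb; congr (_%:R); congr nat_of_bool.
apply/idP/andP => [/set_mem Aw|[/set_mem Aw /eqP next]]; last apply/mem_set.
  split.
    apply/mem_set => -[i|[s i]] kt.
      by have := Aw (inl i); rewrite /= !inE; apply.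
    have st : (s < t)%N by move: kt; rewrite /= inE.
    have := Aw (inr (s, i)); rewrite /= inE ltn_eqF //.
    by apply; exact: ltnW.
  apply/eqP/ffunP => i; rewrite ffunE.
  have := Aw (inr (Ordinal tT, i)); rewrite /= inE eqxx /= ltnS leqnn.
  by apply.
move=> [i|[s i]] /=; rewrite !inE => st.
  by apply: Aw; rewrite /= inE.
case: eqP => [st'|/eqP neq_st]; last first.
  by apply: Aw; rewrite /= inE ltn_neqAle neq_st.
rewrite (_ : s = Ordinal tT); last exact: val_inj.
by rewrite /moves_to /= -next ffunE.
Qed.

(** The event of the past is what makes the induction go through: after one
    stage, the possible next states split it into finitely many smaller events
    of the past of time [t.+1], on each of which state and history are again
    deterministic. *)
Lemma has_mean_cost_to_go g k t x (h : history t) A :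
  (t + k <= T)%N -> primitive A ->
  has_mean P (fun w => \1_(cylinder t A) w * cost_to_go g k x h w)
    (pr P (cylinder t A) * mean_cost_to_go g k x h).
Proof.
elim: k t x h A => [|k IHk] t x h A; rewrite ?addn0 => tkT pA /=.
  have mean_past := has_mean_indic P (cylinder_measurable t pA).
  apply: (eq_has_mean (has_meanZ 0 mean_past)).
    by move=> w /=; rewrite mul0r mulr0.
  by rewrite mul0r mulr0.
have tT : (t < T)%N by rewrite (leq_trans _ tkT) // addnS ltnS leq_addr.
have tkT' : (t.+1 + k <= T)%N by rewrite addSnnS.
have mean_stop := has_meanZ (ell t x [ffun i => g t h (x i)])
  (has_mean_indic P (cylinder_measurable t pA)).
have mean_go := has_mean_sum (fun x' => IHk _ x' [tuple of rcons h (mf x')]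
  _ tkT' (add_move_primitive t x (g t h) x' pA)).
apply: (eq_has_mean (has_meanD mean_stop mean_go)) => [w|] /=.
  rewrite [RHS]mulrDr [X in X + _]mulrC; congr (_ + _).
  rewrite (bigD1 (next_state t x (g t h) w)) //= indic_add_move // eqxx mulr1.
  rewrite big1 ?addr0 // => x' neq.
  by rewrite indic_add_move // eq_sym (negbTE neq) mulr0 mul0r.
rewrite [RHS]mulrDr [X in X + _]mulrC; congr (_ + _).
by rewrite mulr_sumr; apply: eq_bigr => x' _; rewrite add_move_prob // mulrA.
Qed.

(** Identifies the expectation in the dynamic program with a sum against
    [transition_prob]; the transition is [add_move] with the sure event as past. *)
Lemma has_mean_next_state t x gamma (v : S -> R) : (t < T)%N ->
  has_mean P (fun w => v (next_state t x gamma w))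
    (\sum_x' transition_prob t x gamma x' * v x').
Proof.
move=> tT; pose full (k : index) : set Omega := setT.
have pfull : primitive full by move=> [i|[s i]]; exists setT.
have full_cylinder : cylinder t full = setT by rewrite /cylinder bigcapT.
have mean_move := has_mean_sum (fun x' => has_meanZ (v x') (has_mean_indic P
  (cylinder_measurable t.+1 (add_move_primitive t x gamma x' pfull)))).
apply: (eq_has_mean mean_move) => [w|] /=.
  rewrite (bigD1 (next_state t x gamma w)) //= indic_add_move //.
  rewrite full_cylinder indicT eqxx !mulr1 big1 ?addr0 // => x' neq.
  by rewrite indic_add_move // eq_sym (negbTE neq) !mulr0.
apply: eq_bigr => x' _; rewrite add_move_prob // full_cylinder mulrC.
by rewrite /pr probability_setT mul1r.
Qed.

Lemma transition_prob_ge0 t x gamma x' : 0 <= transition_prob t x gamma x'.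
Proof. by apply: prodr_ge0 => i _; rewrite fine_ge0. Qed.

(** * The dynamic program *)

(** Averaging over a class absorbs the relabelling of the starting state, so the
    law of the next state, started from the uniform law on a class, is again
    exchangeable, for every prescription [gamma]. *)
Lemma exchangeable_class_transition t z gamma : (t < T)%N ->
  exchangeable (fun x' =>
    class_mean n_gt0 z (fun x => transition_prob t x gamma x')).
Proof.
move=> tT s x'; rewrite -(class_mean_relabel n_gt0 s); congr (_ * _).
by apply: eq_bigr => x _ /=; rewrite transition_prob_relabel.
Qed.

(** After a transition from a uniform state, the new state is uniform on its class
    given the new mean-field. *)
Lemma class_mean_transition t z gamma (phi : S -> R) : (t < T)%N ->
  class_mean n_gt0 z (fun x => \sum_x' transition_prob t x gamma x' * phi x') =
  class_mean n_gt0 z (fun x =>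
    \sum_x' transition_prob t x gamma x' * class_mean n_gt0 (mf x') phi).
Proof.
move=> tT.
have swap (psi : S -> R) :
    class_mean n_gt0 z
      (fun x => \sum_x' transition_prob t x gamma x' * psi x') =
    \sum_x' class_mean n_gt0 z (fun x => transition_prob t x gamma x') * psi x'.
  rewrite /class_mean exchange_big mulr_sumr /=; apply: eq_bigr => x' _.
  by rewrite -mulr_suml mulrA.
by rewrite !swap exchangeable_sum //; exact: exchangeable_class_transition.
Qed.

Lemma dp_rhsE t v z gamma : (t < T)%N ->
  dp_rhs P n_gt0 f ell W t v z gamma =
  class_mean n_gt0 z (fun x => ell t x [ffun i => gamma (x i)] +
    \sum_x' transition_prob t x gamma x' * v (mf x')).
Proof.
move=> tT; rewrite /dp_rhs class_meanD; congr (_ + _); congr (_ * _).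
apply: eq_bigr => x; rewrite mem_H => /eqP <-.
by have [_ /= ->] := has_mean_next_state x gamma (fun x' => v (mf x')) tT.
Qed.

Section DynamicProgram.
Variable V : nat -> Mn R X n -> R.
Hypothesis V_value : dp_value P T n_gt0 f ell W V.

Local Notation current h := (tnth h ord_max).

Lemma current_rcons t (h : history t) z : current [tuple of rcons h z] = z.
Proof.
by rewrite (tnth_nth z) /= nth_rcons size_tuple ltnn eqxx.
Qed.

(** The policy evaluation equation on mean-fields: the history enters only through
    the prescription [g t h] and the continuation, so that conditionally on it
    the one-step problem is that of the dynamic program. *)
Lemma class_mean_cost_to_goS g k t (h : history t) : (t < T)%N ->
  class_mean n_gt0 (current h) (fun x => mean_cost_to_go g k.+1 x h) =
  dp_rhs P n_gt0 f ell W t (fun z => class_mean n_gt0 z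
      (fun x => mean_cost_to_go g k x [tuple of rcons h z]))
    (current h) (g t h).
Proof.
move=> tT; rewrite dp_rhsE // !class_meanD class_mean_transition //.
congr (_ + _); apply: eq_class_mean => x _; apply: eq_bigr => x' _.
by congr (_ * _); apply: eq_class_mean => y ->.
Qed.

Lemma dp_rhs_le t v v' z gamma : (t < T)%N -> (forall z', v z' <= v' z') ->
  dp_rhs P n_gt0 f ell W t v z gamma <= dp_rhs P n_gt0 f ell W t v' z gamma.
Proof.
move=> tT le_v; rewrite !dp_rhsE //; apply: class_mean_le => x.
rewrite lerD2l; apply: ler_sum => x' _.
by apply: ler_wpM2l (le_v _); exact: transition_prob_ge0.
Qed.

Lemma dp_value_le_cost g k t (h : history t) : (t + k)%N = T ->
  V t (current h) <=
  class_mean n_gt0 (current h) (fun x => mean_cost_to_go g k x h).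
Proof.
case: V_value => VT Vmin.
elim: k t h => [|k IHk] t h; rewrite ?addn0 => tkT.
  have V0 z : V t z = 0 by rewrite tkT VT.
  by rewrite V0 /class_mean big1 ?mulr0.
have tT : (t < T)%N by rewrite -tkT -addSnnS leq_addr.
rewrite class_mean_cost_to_goS //.
have [_ V_le] := Vmin t (current h) tT.
apply: le_trans (V_le _ _) _; first by exists (g t h).
apply: dp_rhs_le => // z.
by have := IHk t.+1 [tuple of rcons h z]; rewrite current_rcons addSnnS; apply.
Qed.

Lemma dp_value_eq_cost psi k t (h : history t) :
  dp_minimizer P T n_gt0 f ell W V psi -> (t + k)%N = T ->
  class_mean n_gt0 (current h)
    (fun x => mean_cost_to_go (markov_strategy psi) k x h) = V t (current h).
Proof.
case: V_value => VT Vmin psi_min.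
elim: k t h => [|k IHk] t h; rewrite ?addn0 => tkT.
  have V0 z : V t z = 0 by rewrite tkT VT.
  by rewrite V0 /class_mean big1 ?mulr0.
have tT : (t < T)%N by rewrite -tkT -addSnnS leq_addr.
rewrite class_mean_cost_to_goS //.
rewrite [X in dp_rhs _ _ _ _ _ _ X](_ : _ = V t.+1); last first.
  apply/funext => z; have := IHk t.+1 [tuple of rcons h z].
  by rewrite current_rcons addSnnS; apply.
(* the minimum is attained at gamma, which psi does at least as well as *)
have [[gamma _ V_gamma] V_le] := Vmin t (current h) tT.
apply/eqP; rewrite eq_le {1}/markov_strategy -{1}V_gamma psi_min //=.
by apply: V_le; eexists.
Qed.

End DynamicProgram.

(** * Cost of a strategy and optimality *)

Definition initial (x : S) : R := \prod_i PX (x i).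

Lemma exchangeable_initial : exchangeable initial.
Proof.
move=> s x; rewrite /initial [RHS](reindex_inj (@perm_inj _ s)) /=.
by apply: eq_bigr => i _; rewrite ffunE.
Qed.

Lemma initial_ge0 x : 0 <= initial x.
Proof.
apply: prodr_ge0 => i _; rewrite -lee_fin.
by have [_ <-] := X1_pmf i (x i).
Qed.

Lemma cost_to_go_trajectory g k t w :
  let: (x, h) := trajectory n_gt0 f X1 W g w t in
  cost_to_go g k x h w =
  \sum_(t <= s < t + k) ell s (state n_gt0 f X1 W g w s)
                              (action n_gt0 f X1 W g w s).
Proof.
elim: k t => [|k IHk] t; first by case: trajectory => x h; rewrite addn0 big_geq.
rewrite big_ltn ?addnS ?ltnS ?leq_addr // -addSn.
move: (IHk t.+1); rewrite /action /state /=.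
by case: trajectory => x h /= <-.
Qed.

(** The initial state is made deterministic by splitting on its finitely many
    values; [has_mean_cost_to_go] then applies at time [0] to each of the events
    [start x]. *)
Lemma cost_mean g : J P T n_gt0 f ell X1 W g =
  (\sum_x initial x * mean_cost_to_go g T x [tuple mf x])%:E.
Proof.
pose start (x : S) (k : index) : set Omega :=
  if k is inl i then X1 i @^-1` [set x i] else setT.
have pstart x : primitive (start x).
  by move=> [i|[s i]]; [exists [set x i]|exists setT].
have start_prob x : pr P (cylinder 0 (start x)) = initial x.
  rewrite cylinder_prob // (eq_bigl (mem [set inl i | i : 'I_n]%SET)).
    rewrite big_imset /= => [|i j _ _ [] //]; apply: eq_bigr => i _.
    by rewrite /pr (X1_pmf i (x i)).2.
  move=> [i|[s i]]; rewrite !inE /=; first by rewrite imset_f.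
  by symmetry; apply/negbTE/imsetP => -[].
have [_ <-] : has_mean P (fun w => \sum_(t < T)
    ell t (state n_gt0 f X1 W g w t) (action n_gt0 f X1 W g w t))
    (\sum_x initial x * mean_cost_to_go g T x [tuple mf x]); last by [].
have mean_start := has_mean_sum (fun x =>
  has_mean_cost_to_go g x [tuple mf x] (leqnn T) (pstart x)).
apply: (eq_has_mean mean_start) => [w|]; last first.
  by apply: eq_bigr => x _; rewrite start_prob.
have := cost_to_go_trajectory g T 0 w; rewrite /= add0n big_mkord => <-.
set x0 := [ffun i => X1 i w].
have start_indic x : \1_(cylinder 0 (start x)) w = (x0 == x)%:R :> R.
  rewrite indicE; congr (_%:R); congr nat_of_bool.
  apply/idP/eqP => [/set_mem Aw|<-].
    by apply/ffunP => i; rewrite ffunE; apply: (Aw (inl i)); rewrite /= inE.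
  by apply/mem_set => -[i|[s i]] //= _; rewrite ffunE.
rewrite (bigD1 x0) //= start_indic eqxx mul1r big1 ?addr0 // => x neq.
by rewrite start_indic eq_sym (negbTE neq) mul0r.
Qed.

(** The initial law is exchangeable, hence a state may be averaged over its class,
    in which the history stays the same. *)
Lemma cost_mean_class g : J P T n_gt0 f ell X1 W g =
  (\sum_x initial x * class_mean n_gt0 (mf x)
     (fun y => mean_cost_to_go g T y [tuple mf x]))%:E.
Proof.
rewrite cost_mean exchangeable_sum; last exact: exchangeable_initial.
congr (_%:E); apply: eq_bigr => x _; congr (_ * _).
by apply: eq_class_mean => y ->.
Qed.

Lemma markov_strategy_optimal V psi g :
  dp_value P T n_gt0 f ell W V -> dp_minimizer P T n_gt0 f ell W V psi ->
  (J P T n_gt0 f ell X1 W (markov_strategy psi) <=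
   J P T n_gt0 f ell X1 W g)%E.
Proof.
move=> V_value psi_min; rewrite !cost_mean_class lee_fin.
apply: ler_sum => x _; apply: ler_wpM2l; first exact: initial_ge0.
have := dp_value_le_cost V_value g (t := 0) [tuple mf x] (add0n T).
have := dp_value_eq_cost V_value (t := 0) [tuple mf x] psi_min (add0n T).
by rewrite !(tnth_nth (mf x)) /= => ->.
Qed.

End Control.

Theorem corollary1 (R : realType) (d : measure_display)
    (Omega : measurableType d) (P : probability Omega R)
    (X U : finType) (calW : nat -> countType)
    (n T : nat) (n_gt0 : (0 < n)%N)
    (f : forall t, X -> U -> calW t -> Mn R X n -> X)
    (ell : nat -> {ffun 'I_n -> X} -> {ffun 'I_n -> U} -> R)
    (X1 : 'I_n -> Omega -> X) (W : forall t, 'I_n -> Omega -> calW t)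
    (PX : X -> R) (PW : forall t, calW t -> R)
    (X1_pmf : forall i, has_pmf P (X1 i) PX)
    (W_pmf : forall t i, (t < T)%N -> has_pmf P (W t i) (PW t))
    (indep : mutually_independent P (primitive_events T X1 W))
    (V : nat -> Mn R X n -> R)
    (V_value : dp_value P T n_gt0 f ell W V)
    (psi : nat -> Mn R X n -> X -> U)
    (psi_min : dp_minimizer P T n_gt0 f ell W V psi)
    (g : strategy R X U n) :
  (J P T n_gt0 f ell X1 W (markov_strategy psi)
     <= J P T n_gt0 f ell X1 W g)%E.
Proof. exact: (markov_strategy_optimal X1_pmf W_pmf indep g V_value psi_min). Qed.
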